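(* Let $\rho \colon E \to L$ be a characteristic map of partial groupoids with $L$ not a groupoid. Then $\deg(L) \leq h(\rho)$. If $E_0$ satisfies the descending chain condition on closed subsets (for $\mathrm{cl}_\rho$), then $h(\rho) \leq \deg(L)$.
   Context: Let $\Upsilon$ be the category with objects $[n]=\{0,1,\dots,n\}$, $n\ge 0$, and all functions as morphisms. A symmetric set is a functor $X\colon\Upsilon^{\mathrm{op}}\to\mathsf{Set}$; write $X_n=X([n])$. Restricting to order-preserving maps gives its underlying simplicial set, with faces $d_i$ and degeneracies $s_i$. Let $\epsilon_{ij}\colon[1]\to[n]$ send $0\mapsto i$, $1\mapsto j$. A symmetric set $X$ is spiny if for all $n\ge1$ the map $X_n\to\prod_{i=1}^n X_1$, $x\mapsto(\epsilon_{01}^*x,\dots,\epsilon_{n-1,n}^*x)$, is injective. A partial groupoid is a spiny symmetric set. The nerve of a groupoid is regarded as a symmetric set ($n$-simplices are functors from the groupoid with object set $[n]$ and exactly one morphism between any two objects); a partial groupoid ''is a groupoid'' if it is isomorphic to such a nerve. Degree: $I\subset[n]$ is gapped if distinct elements of $I$ differ by at least $2$. For $k\ge1$, a simplicial set $X$ is lower $(2k-1)$-Segal if for every $n$ and every gapped $I\subset[n]$ of cardinality $k+1$, the cube $J\mapsto X_{[n]\setminus J}$ ($J\subseteq I$) is a limit diagram; i.e., for every family $(x_i)_{i\in I}$ in $X_{n-1}$ with $d_ix_j=d_{j-1}x_i$ for all $i<j$ in $I$, there is a unique $x\in X_n$ with $d_ix=x_i$ for all $i\in I$. A symmetric set is lower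 $(2k-1)$-Segal if its underlying simplicial set is. $\deg(X)$ is the least $k\ge1$ such that $X$ is lower $(2k-1)$-Segal, and $\infty$ if there is none. Actions: the star of $x\in X_0$ is the set of all simplices of $X$ (of all dimensions) whose initial vertex is $x$. A map $\rho\colon E\to L$ of partial groupoids is star injective if for every $x\in E_0$ the induced map from the star of $x$ to the star of $\rho(x)$ is injective. A characteristic map is a star injective map $\rho\colon E\to L$ with $E$ a groupoid and $\rho$ surjective in every degree. For $f\in L_n$, its domain $\mathrm{D}(f)\subseteq E_0$ is the set of $x\in E_0$ for which there is $\tilde f\in E_n$ with initial vertex $x$ and $\rho(\tilde f)=f$. The closure operator on $E_0$ is $\mathrm{cl}_\rho(A)=\bigcap_{f:\,A\subseteq \mathrm{D}(f)}\mathrm{D}(f)$, over all simplices $f$ of $L$ (of all dimensions), an empty intersection being $E_0$; $A$ is closed if $\mathrm{cl}_\rho(A)=A$. Helly number: let $S$ be a closure space with operator $\mathrm{cl}$ and $\mathrm{cl}(\varnothing)=\varnothing$. A family $(A_i)_{i\in I}$ of nonempty subsets is Helly independent if $\bigcap_J \mathrm{cl}(\bigcup_{j\in J}A_j)=\varnothing$, where $J$ ranges over $I$ and all sets $I\setminus\{i\}$, $i\in I$. $h(S)$ is the maximal size of a finite Helly independent family, with $h(S)=\infty$ if there are such families of arbitrarily large finite size. $h(\rho)$ is the Helly number of $(E_0,\mathrm{cl}_\rho)$; when $L$ is not a groupoid, $\varnothing$ is closed so this is defined. *)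

(* Defs.v *)
From mathcomp Require Import all_boot.
From mathcomp Require Import boolp classical_sets functions.

Set Implicit Arguments.
Unset Strict Implicit.
Unset Printing Implicit Defensive.

Local Open Scope classical_set_scope.

(** * Symmetric sets *)

(* A presheaf on the category with objects [n] = 'I_n.+1 and all functions as
   morphisms; [act f] is the map X_n -> X_m usually written f^*.             *)
Record symset := SymSet {
  simp :> nat -> Type;
  act : forall m n : nat, ('I_m.+1 -> 'I_n.+1) -> simp n -> simp m;
  act_id : forall n (x : simp n), act id x = x;
  act_comp : forall m n p (g : 'I_p.+1 -> 'I_m.+1) (f : 'I_m.+1 -> 'I_n.+1)
    (x : simp n), act (f \o g) x = act g (act f x)
}.

Record symmap (X Y : symset) := SymMap {
  symmap_fun :> forall n, X n -> Y n;
  symmap_act : forall m n (f : 'I_m.+1 -> 'I_n.+1) (x : X n),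
    symmap_fun (act f x) = act f (symmap_fun x)
}.

Definition isomorphic (X Y : symset) : Prop :=
  exists (f : symmap X Y) (g : symmap Y X),
    forall n, cancel (f n) (g n) /\ cancel (g n) (f n).

Section Spine.
Variables (X : symset) (n : nat).

Definition eps (i j : 'I_n.+1) : 'I_2 -> 'I_n.+1 :=
  fun k => if k == ord0 then i else j.

Definition spine (x : X n) : 'I_n -> X 1 :=
  fun i => act (eps (widen_ord (leqnSn n) i) (lift ord0 i)) x.

End Spine.

Definition spiny (X : symset) : Prop :=
  forall n, 1 <= n -> injective (@spine X n).

Record partial_groupoid := PartialGroupoid {
  pg_symset :> symset;
  pg_spiny : spiny pg_symset
}.

(** * Groupoids and their nerves *)

Record groupoid := Groupoid {
  ob :> Type;
  hom : ob -> ob -> Type;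
  idm : forall a, hom a a;
  (* diagrammatic order *)
  comp : forall a b c, hom a b -> hom b c -> hom a c;
  inv : forall a b, hom a b -> hom b a;
  comp_idl : forall a b (f : hom a b), comp (idm a) f = f;
  comp_idr : forall a b (f : hom a b), comp f (idm b) = f;
  comp_assoc : forall a b c d (f : hom a b) (g : hom b c) (h : hom c d),
    comp f (comp g h) = comp (comp f g) h;
  comp_invr : forall a b (f : hom a b), comp f (inv f) = idm a;
  comp_invl : forall a b (f : hom a b), comp (inv f) f = idm b
}.

Record gfunctor (G H : groupoid) := GFunctor {
  fob :> G -> H;
  fhom : forall a b, hom a b -> hom (fob a) (fob b);
  fhom_id : forall a, fhom (idm a) = idm (fob a);
  fhom_comp : forall a b c (f : hom a b) (g : hom b c),
    fhom (comp f g) = comp (fhom f) (fhom g)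
}.

Program Definition gfunctor_comp (G H K : groupoid) (F' : gfunctor H K)
    (F : gfunctor G H) : gfunctor G K :=
  {| fob := fun a => F' (F a); fhom := fun a b f => fhom F' (fhom F f) |}.
Next Obligation. by rewrite !fhom_id. Qed.
Next Obligation. by rewrite !fhom_comp. Qed.

(* The groupoid with objects [n] and exactly one morphism between any two. *)
Program Definition chaotic (n : nat) : groupoid :=
  {| ob := 'I_n.+1; hom := fun _ _ => unit; idm := fun _ => tt;
     comp := fun _ _ _ _ _ => tt; inv := fun _ _ _ => tt |}.
Next Obligation. by case: f. Qed.
Next Obligation. by case: f. Qed.

Program Definition chaotic_map m n (f : 'I_m.+1 -> 'I_n.+1) :
    gfunctor (chaotic m) (chaotic n) :=
  {| fob := (f : chaotic m -> chaotic n); fhom := fun _ _ u => u |}.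

Program Definition nerve (G : groupoid) : symset :=
  {| simp := fun n => gfunctor (chaotic n) G;
     act := fun m n f F => gfunctor_comp F (chaotic_map f) |}.
Next Obligation.
by case: x => o h hi hc; congr GFunctor; exact: Prop_irrelevance.
Qed.
Next Obligation.
by case: x => o h hi hc; congr GFunctor; exact: Prop_irrelevance.
Qed.

Definition is_groupoid (X : symset) : Prop :=
  exists G : groupoid, isomorphic X (nerve G).

(** * Extended natural numbers *)

Definition enat := option nat.

Definition le_enat (a b : enat) : Prop :=
  match a, b with
  | _, None => True
  | None, Some _ => False
  | Some m, Some n => m <= n
  end.

Definition least (P : nat -> Prop) (k : nat) : Prop :=
  P k /\ forall m, P m -> k <= m.

Definition greatest (P : nat -> Prop) (k : nat) : Prop :=
  P k /\ forall m, P m -> m <= k.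

(* The number satisfying Q (unique in all uses below), and infinity, encoded
   by None, if there is none.                                               *)
Definition enat_of (Q : nat -> Prop) : enat :=
  if pselect (exists k, Q k) is left e then Some (sval (cid e)) else None.

(** * Degree *)

(* Faces of the underlying simplicial set: [lift i] is the order-preserving
   injection [n] -> [n+1] that omits i.                                     *)
Definition face (X : symset) n (i : 'I_n.+2) : X n.+1 -> X n :=
  @act X n n.+1 (lift i).

Definition gapped n (I : {set 'I_n.+1}) : Prop :=
  forall i j, i \in I -> j \in I -> i < j -> i + 2 <= j.

(* lower_segal k is the lower (2k-1)-Segal condition, for k >= 1.  A gapped
   subset of [n] with k + 1 >= 2 elements only exists for n >= 2, whence the
   index n.+2.  In the compatibility condition i < j, so that both i and j - 1
   lie in [n.+1] and inord does not truncate.                               *)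
Definition lower_segal (k : nat) (X : symset) : Prop :=
  forall (n : nat) (I : {set 'I_n.+3}), gapped I -> #|I| = k.+1 ->
  forall x : {i : 'I_n.+3 | i \in I} -> X n.+1,
    (forall i j : {i : 'I_n.+3 | i \in I}, val i < val j ->
       face (inord (val i)) (x j) = face (inord (val j).-1) (x i)) ->
    exists! y : X n.+2, forall i : {i : 'I_n.+3 | i \in I},
      face (val i) y = x i.

Definition deg (X : symset) : enat :=
  enat_of (least (fun k => 1 <= k /\ lower_segal k X)).

(** * Characteristic maps *)

Definition init (X : symset) n (x : X n) : X 0 :=
  act (fun _ : 'I_1 => ord0) x.

(* The n-simplices of the star of x. *)
Definition star (X : symset) (n : nat) (x : X 0) : set (X n) :=
  [set s | init s = x].

Definition star_injective (E L : symset) (rho : symmap E L) : Prop :=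
  forall (x : E 0) (n : nat), set_inj (@star E n x) (rho n).

Definition characteristic (E L : symset) (rho : symmap E L) : Prop :=
  [/\ star_injective rho, is_groupoid E
    & forall n (f : L n), exists e : E n, rho n e = f].

Definition domain (E L : symset) (rho : symmap E L) n (f : L n) : set (E 0) :=
  [set x | exists e : E n, init e = x /\ rho n e = f].

Definition cl_rho (E L : symset) (rho : symmap E L) (A : set (E 0)) :
    set (E 0) :=
  [set x | forall n (f : L n), A `<=` domain rho f -> domain rho f x].

(** * Helly number *)

Section Closure.
Variables (S : Type) (cl : set S -> set S).

Definition cl_closed (A : set S) : Prop := cl A = A.

Definition dcc_closed : Prop :=
  forall C : nat -> set S,
    (forall n, cl_closed (C n)) -> (forall n, C n.+1 `<=` C n) ->
    exists N, forall n, N <= n -> C n = C N.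

Definition Helly_independent (I : Type) (A : I -> set S) : Prop :=
  (forall i, A i !=set0) /\
  cl (\bigcup_j A j) `&`
    \bigcap_i cl (\bigcup_(j in [set j | j <> i]) A j) = set0.

(* A subfamily of a Helly independent family is Helly independent when cl is a
   closure operator, so having no greatest size means having arbitrarily large
   finite sizes (the empty family has size 0).                              *)
Definition helly_number : enat :=
  enat_of (greatest (fun n => exists A : 'I_n -> set S, Helly_independent A)).

End Closure.

(* Main.v *)
(* An [n]-simplex of a partial groupoid is determined by its edges out of any
   one vertex, so [L] is a family of finite sets of edges with common source,
   and such a set belongs to it iff all its edges lift at one point of [E].
   Lower (2k-1)-Segal means that a set of edges at a vertex is a simplex as
   soon as it contains k + 1 edges each of whose removal leaves a simplex.

   If a compatible family (x_i) in [L] has no filler, then the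
   points of [E] at which the x_i lift form a Helly independent family: a point
   in all the closures would lift every edge, hence a filler.  Conversely, by
   the descending chain condition a Helly independent family (A_i) yields
   finitely many edges, with domains each containing all A_j but one, and with
   no common lift.  In a minimal such set of edges every index i is the
   exceptional one of some edge, so there are at least as many edges as A_i,
   and the Segal condition bounds their number.  The edges have a common source
   when there are three or more A_i; this covers all cases, because lower
   1-Segal partial groupoids are groupoids. *)

Require Import Defs.
From mathcomp Require Import all_boot.
From mathcomp Require Import boolp classical_sets functions.
From mathcomp Require Import zify.

(* [comp], [inv] and others are shadowed by the libraries loaded after Defs. *)
Import Defs.

Set Implicit Arguments.
Unset Strict Implicit.
Unset Printing Implicit Defensive.

Local Open Scope classical_set_scope.

(** * Edges of simplices *)

Definition vertex (X : symset) n (x : X n) (i : 'I_n.+1) : X 0 :=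
  act (fun _ : 'I_1 => i) x.

Definition edge (X : symset) n (x : X n) (i j : 'I_n.+1) : X 1 :=
  act (eps i j) x.

Section Edges.
Variable X : symset.

Lemma act_act m n p (g : 'I_p.+1 -> 'I_m.+1) (f : 'I_m.+1 -> 'I_n.+1) h
  (x : X n) : (forall a, f (g a) = h a) -> act g (act f x) = act h x.
Proof. by move=> fgh; rewrite -act_comp; congr act; apply/funext => a /=. Qed.

Lemma act_id_eq n (h : 'I_n.+1 -> 'I_n.+1) (x : X n) :
  (forall a, h a = a) -> act h x = x.
Proof. by move=> h1; rewrite -[RHS]act_id; congr act; apply/funext. Qed.

Lemma edge_act m n (f : 'I_m.+1 -> 'I_n.+1) (x : X n) i j :
  edge (act f x) i j = edge x (f i) (f j).
Proof. by apply: act_act => a; rewrite /eps; case: ifP. Qed.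

Lemma vertex_act m n (f : 'I_m.+1 -> 'I_n.+1) (x : X n) i :
  vertex (act f x) i = vertex x (f i).
Proof. exact: act_act. Qed.

Lemma vertex_edge n (x : X n) i j k :
  vertex (edge x i j) k = vertex x (eps i j k).
Proof. exact: vertex_act. Qed.

Lemma init_edge n (x : X n) i j : init (edge x i j) = vertex x i.
Proof. exact: vertex_edge. Qed.

Lemma edge_edge n (x : X n) i j k l :
  edge (edge x i j) k l = edge x (eps i j k) (eps i j l).
Proof. exact: edge_act. Qed.

Lemma vertex0 (z : X 0) i : vertex z i = z.
Proof. by apply: act_id_eq => a; rewrite (ord1 a) (ord1 i). Qed.

Lemma edge01 (f : X 1) : edge f ord0 ord_max = f.
Proof.
apply: act_id_eq => a; rewrite /eps.
by case: a => -[|[|//]] i; apply/val_inj.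
Qed.

Lemma edge_diag n (x : X n) i :
  edge x i i = edge (vertex x i) ord0 ord0.
Proof. by rewrite edge_act. Qed.

Lemma init_hub n (x : X n) : init x = vertex x ord0.
Proof. by []. Qed.

End Edges.

(* The edges from [j] determine those of the triangle (i, j, i + 1), whose
   spine they are up to reversal. *)
Lemma hub_inj (X : symset) : spiny X -> forall n (x y : X n) (j : 'I_n.+1),
  (forall s, edge x j s = edge y j s) -> x = y.
Proof.
move=> spX n x y j exy; case: n => [|n] in x y j exy *.
  have := congr1 (fun e => vertex e ord0) (exy ord0).
  by rewrite !vertex_edge !vertex0.
apply: (spX n.+1) => //; apply/funext => i.
rewrite /spine; move: (widen_ord _ _) (lift _ _) => a b.
pose t : 'I_3 -> 'I_n.+2 := fun s => if s == ord0 then a else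
   if s == ord_max then b else j.
pose s1 : 'I_3 := inord 1.
have v1 : val s1 = 1 by rewrite /s1 /= inordK.
have t1 : t s1 = j by rewrite /t -!val_eqE v1.
suff etxy : act t x = act t y.
  by have := congr1 (fun u => edge u ord0 ord_max) etxy; rewrite !edge_act /t.
apply: (spX 2) => //; apply/funext => k; rewrite /spine -!/(edge _ _ _).
rewrite !edge_act; case: k => -[|[|//]] lk.
  have -> : t (lift ord0 (Ordinal lk)) = j by rewrite -t1; congr t; apply/val_inj; rewrite v1.
  have /= := congr1 (fun u => edge u ord_max ord0) (exy (t (widen_ord (leqnSn 2) (Ordinal lk)))).
  by rewrite !edge_edge.
have -> : t (widen_ord (leqnSn 2) (Ordinal lk)) = j
  by rewrite -t1; congr t; apply/val_inj; rewrite v1.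
exact: exy.
Qed.

(** Among spiny symmetric sets this characterizes nerves of groupoids. The condition [init w = z]
    only has content for [m = 0]. *)
Definition hub_complete (X : symset) : Prop :=
  forall m (z : X 0) (g : 'I_m -> X 1), (forall l, init (g l) = z) ->
  exists w : X m, init w = z /\ forall l, edge w ord0 (lift ord0 l) = g l.

(** * Groupoids have all simplices with given edges out of a vertex *)

(* Equality of functors is stated through the total type of arrows, so that no
   transport along equalities of objects is needed. *)
Definition arrow (G : groupoid) : Type := {a : G & {b : G & hom a b}}.

Definition mk_arrow (G : groupoid) (a b : G) (h : hom a b) : arrow G :=
  existT _ a (existT _ b h).

Lemma existT_inj (T : Type) (P : T -> Type) (a : T) (p q : P a) :
  existT P a p = existT P a q -> p = q.
Proof.
move=> e; have := projT2_eq e.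
by rewrite (_ : projT1_eq e = erefl a) //; apply: Prop_irrelevance.
Qed.

Lemma mk_arrow_inj (G : groupoid) (a b : G) (h h' : hom a b) :
  mk_arrow h = mk_arrow h' -> h = h'.
Proof. by move=> e; apply: existT_inj (existT_inj e). Qed.

Lemma chaotic_functor_eq (G : groupoid) n (F F' : gfunctor (chaotic n) G) :
  (forall i j : 'I_n.+1, mk_arrow (@fhom _ _ F i j tt) = mk_arrow (@fhom _ _ F' i j tt)) ->
  F = F'.
Proof.
case: F F' => [o h h1 h2] [o' h' h1' h2'] /= FF'.
have eo : o = o' by apply/funext => i; have := congr1 (@projT1 _ _) (FF' i i).
subst o'.
have eh : h = h'.
  apply: functional_extensionality_dep => i.
  apply: functional_extensionality_dep => j.
  by apply/funext => -[]; apply: mk_arrow_inj.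
by subst h'; congr GFunctor; apply: Prop_irrelevance.
Qed.

Lemma fhom_inv (G H : groupoid) (F : gfunctor G H) a b (f : hom a b) :
  fhom F (inv f) = inv (fhom F f).
Proof.
rewrite -[LHS]comp_idl -(comp_invl (fhom F f)) -comp_assoc -fhom_comp.
by rewrite comp_invr fhom_id comp_idr.
Qed.

(** The arrow from 0 to 1 determines the other three: its inverse and the identities of its ends. *)
Lemma chaotic1_eq (G : groupoid) (F F' : gfunctor (chaotic 1) G) :
  mk_arrow (@fhom _ _ F (ord0 : 'I_2) (ord_max : 'I_2) tt) =
  mk_arrow (@fhom _ _ F' (ord0 : 'I_2) (ord_max : 'I_2) tt) -> F = F'.
Proof.
pose i0 : chaotic 1 := (ord0 : 'I_2); pose i1 : chaotic 1 := (ord_max : 'I_2).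
pose src (u : arrow G) := mk_arrow (idm (projT1 u)).
pose tgt (u : arrow G) := mk_arrow (idm (projT1 (projT2 u))).
pose rev (u : arrow G) := mk_arrow (inv (projT2 (projT2 u))).
move=> e; apply: chaotic_functor_eq => i j.
have I2 (k : 'I_2) : k = i0 \/ k = i1.
  by case: k => -[|[|//]] ?; [left|right]; apply/val_inj.
have idE (K : gfunctor (chaotic 1) G) (k : chaotic 1) :
  @fhom _ _ K k k tt = idm (K k) by rewrite -fhom_id.
have revE (K : gfunctor (chaotic 1) G) :
  @fhom _ _ K i1 i0 tt = inv (@fhom _ _ K i0 i1 tt) by rewrite -fhom_inv.
case: (I2 i) (I2 j) => -> [] ->.
- by rewrite !idE; apply: (congr1 src e).
- exact: e.
- by rewrite !revE; apply: (congr1 rev e).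
- by rewrite !idE; apply: (congr1 tgt e).
Qed.

Lemma nerve_hub_complete (G : groupoid) : hub_complete (nerve G).
Proof.
move=> m z g gz.
pose a : G := fob z (ord0 : 'I_1).
(* The source of [g l] equals [a] only propositionally; [bh l] is the same arrow with source [a]
   itself. *)
pose to_arrow (bh : {b : G & hom a b}) : arrow G := existT _ a bh.
have /choice[bh bhP] : forall l, exists bh, to_arrow bh =
    mk_arrow (@fhom _ _ (g l) (ord0 : 'I_2) (ord_max : 'I_2) tt).
  move=> l.
  have ga : fob (g l) (ord0 : 'I_2) = a by rewrite /a -(gz l).
  rewrite /to_arrow; move: (fhom _ _); rewrite /mk_arrow.
  move: (fob (g l) (ord_max : 'I_2)) => b.
  by move: (fob (g l) _) ga => a' -> h; exists (existT _ b h).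
pose o (i : 'I_m.+1) := if unlift ord0 i is Some l then projT1 (bh l) else a.
pose h (i : 'I_m.+1) : hom a (o i) :=
  match unlift ord0 i as u return
    hom a (if u is Some l then projT1 (bh l) else a)
  with Some l => projT2 (bh l) | None => idm a end.
have F1 (i : chaotic m) : comp (inv (h i)) (h i) = idm (o i).
  exact: comp_invl.
have F2 (i j k : chaotic m) : comp (inv (h i)) (h k) =
    comp (comp (inv (h i)) (h j)) (comp (inv (h j)) (h k)).
  by rewrite comp_assoc -[in RHS](comp_assoc _ (h j)) comp_invr comp_idr.
pose F : gfunctor (chaotic m) G :=
  {| fob := (o : chaotic m -> G);
     fhom := fun i j _ => comp (inv (h i)) (h j);
     fhom_id := F1; fhom_comp := fun i j k _ _ => F2 i j k |}.
have inv_idm : inv (idm a) = idm a by rewrite -[LHS]comp_idl comp_invr.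
exists F; split=> [|l].
  apply: chaotic_functor_eq => i j; rewrite (ord1 i) (ord1 j).
  have -> : @fhom _ _ z (ord0 : 'I_1) (ord0 : 'I_1) tt = idm (fob z (ord0 : 'I_1)).
    by rewrite -fhom_id.
  by rewrite /= comp_invl /o unlift_none.
apply: chaotic1_eq; rewrite -bhP /= /eps /=.
rewrite /h /o unlift_none liftK /=.
by rewrite inv_idm comp_idl /mk_arrow /to_arrow; case: (bh l).
Qed.

Lemma groupoid_hub_complete (X : symset) : is_groupoid X -> hub_complete X.
Proof.
move=> [G [f [f' ff']]] m z g gz.
have [w [wz wg]] := @nerve_hub_complete G m (f 0 z) (fun l => f 1 (g l))
  (fun l => esym (etrans (congr1 (f 0) (esym (gz l))) (symmap_act f _ _))).
exists (f' m w); split=> [|l].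
  by rewrite /init -symmap_act -/(init w) wz (ff' 0).1.
by rewrite /edge -symmap_act -/(edge w _ _) wg (ff' 1).1.
Qed.

(** * The groupoid of a symmetric set with all such simplices *)

Lemma bij_isomorphic (X Y : symset) (f : symmap X Y) :
  (forall n, injective (f n)) -> (forall n (y : Y n), exists x, f n x = y) ->
  isomorphic X Y.
Proof.
move=> finj fsurj.
pose g n (y : Y n) := sval (cid (fsurj n y)).
have gK n (y : Y n) : f n (g n y) = y by rewrite /g; case: cid.
have gact m n (u : 'I_m.+1 -> 'I_n.+1) (y : Y n) : g m (act u y) = act u (g n y).
  by apply: finj; rewrite symmap_act !gK.
exists f, (SymMap gact) => n; split=> [x|y]; last exact: gK.
by apply: finj; rewrite gK.
Qed.

Section GroupoidOfHubs.
Variable X : symset.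
Hypotheses (spX : spiny X) (hubX : hub_complete X).

Let i0 : 'I_3 := inord 0.
Let i1 : 'I_3 := inord 1.
Let i2 : 'I_3 := inord 2.

Definition rev (f : X 1) : X 1 := edge f ord_max ord0.

Definition tgt (f : X 1) : X 0 := vertex f ord_max.

Definition triangle (f g : X 1) (w : X 2) : Prop :=
  edge w i0 i1 = f /\ edge w i1 i2 = g.

(** The triangle is unique by spininess and exists by [hubX] when [tgt f = init g]; [f] is only a
    default value. *)
Definition compose (f g : X 1) : X 1 :=
  if pselect (exists w, triangle f g w) is left e
  then edge (sval (cid e)) i0 i2 else f.

Lemma triangle_inj f g w w' : triangle f g w -> triangle f g w' -> w = w'.
Proof.
move=> [a b] [a' b']; apply: (spX (n := 2)) => //; apply/funext => k.
rewrite /spine -!/(edge _ _ _); case: k => -[|[|//]] lk.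
  rewrite (_ : widen_ord _ _ = i0); last by apply/val_inj; rewrite /= inordK.
  rewrite (_ : lift _ _ = i1); last by apply/val_inj; rewrite /= inordK.
  by rewrite a.
rewrite (_ : widen_ord _ _ = i1); last by apply/val_inj; rewrite /= inordK.
rewrite (_ : lift _ _ = i2); last by apply/val_inj; rewrite /= inordK.
by rewrite b.
Qed.

(** The groupoid laws below follow from this by placing the edges involved in a single simplex. *)
Lemma compose_edge n (x : X n) i j k :
  compose (edge x i j) (edge x j k) = edge x i k.
Proof.
pose t : 'I_3 -> 'I_n.+1 := fun s => if s == i0 then i else
   if s == i1 then j else k.
have [t0 t1 t2] : [/\ t i0 = i, t i1 = j & t i2 = k].
  by rewrite /t; split; rewrite -?val_eqE /= !inordK.
have tx : triangle (edge x i j) (edge x j k) (act t x).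
  by split; rewrite edge_act ?t0 t1 ?t2.
rewrite /compose; case: pselect => [e|[]]; last by exists (act t x).
case: cid => w /= wP; rewrite (triangle_inj wP tx).
by rewrite edge_act t0 t2.
Qed.

Lemma edge_rev n (x : X n) i j : rev (edge x i j) = edge x j i.
Proof. by rewrite /rev edge_edge. Qed.

Lemma tgt_edge n (x : X n) i j : tgt (edge x i j) = vertex x j.
Proof. by rewrite /tgt vertex_edge. Qed.

Lemma compose_ex f g : tgt f = init g ->
  exists n (w : X n) i j k, edge w i j = f /\ edge w j k = g.
Proof.
move=> fg.
have [l|w [_ wE]] := @hubX 2 (tgt f) (fun l => if l == ord0 then rev f else g).
  by case: ifP => _ //; rewrite /rev init_edge.
exists 2, w, i1, i0, i2.
have w1 := wE ord0; have w2 := wE ord_max.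
rewrite (_ : lift _ _ = i1) in w1; last by apply/val_inj; rewrite /= inordK.
rewrite (_ : lift _ _ = i2) in w2; last by apply/val_inj; rewrite /= inordK.
have e0 : i0 = ord0 by apply/val_inj; rewrite /= inordK.
rewrite e0 w2 /=; split=> //.
by rewrite -edge_rev w1 /= /rev edge_edge /= edge01.
Qed.

Lemma init_compose f g : tgt f = init g -> init (compose f g) = init f.
Proof.
move=> /compose_ex[n [w [i [j [k [<- <-]]]]]].
by rewrite compose_edge !init_edge.
Qed.

Lemma tgt_compose f g : tgt f = init g -> tgt (compose f g) = tgt g.
Proof.
move=> /compose_ex[n [w [i [j [k [<- <-]]]]]].
by rewrite compose_edge !tgt_edge.
Qed.

Lemma compose_revK f g : tgt f = init g -> compose (rev f) (compose f g) = g.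
Proof.
move=> /compose_ex[n [w [i [j [k [<- <-]]]]]].
by rewrite edge_rev !compose_edge.
Qed.

Lemma init_rev f : init (rev f) = tgt f.
Proof. exact: init_edge. Qed.

Lemma tgt_rev f : tgt (rev f) = init f.
Proof. exact: tgt_edge. Qed.

Lemma revK f : rev (rev f) = f.
Proof. by rewrite /rev edge_edge edge01. Qed.

Lemma compose_cancel f g g' : tgt f = init g -> tgt f = init g' ->
  compose f g = compose f g' -> g = g'.
Proof. by move=> fg fg' e; rewrite -(compose_revK fg) e compose_revK. Qed.

Lemma composeA f g h : tgt f = init g -> tgt g = init h ->
  compose f (compose g h) = compose (compose f g) h.
Proof.
move=> fg gh.
(* The hub is the end of [f]; the other vertices are the start of [f] and the ends of [g] and [h].
   The edge joining the last two is [h] by cancellation of [g]. *)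
pose c (l : 'I_3) := if l == i0 then rev f else if l == i1 then g else compose g h.
have [l|w [_ wE]] := @hubX 3 (tgt f) c.
  rewrite /c; case: ifP => _; first exact: init_rev.
  by case: ifP => _; rewrite ?init_compose.
have w1 := wE i0; have w2 := wE i1; have w3 := wE i2.
rewrite /c in w1 w2 w3.
rewrite eqxx in w1; rewrite -!val_eqE /= !inordK //= in w2 w3.
set o := ord0 in w1 w2 w3.
have fE : f = edge w (lift o i0) o by rewrite -edge_rev w1 revK.
have hE : h = edge w (lift o i1) (lift o i2).
  apply: (@compose_cancel g) => //=.
    by rewrite init_edge -w2 tgt_edge.
  by rewrite -{2}w2 compose_edge w3.
by rewrite {2}hE fE -w3 -w2 !compose_edge.
Qed.

Definition harrow (a b : X 0) : Type := {f : X 1 | init f = a /\ tgt f = b}.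

Definition ident (a : X 0) : X 1 := edge a ord0 ord0.

Lemma harrow_inj a b (f g : harrow a b) : sval f = sval g -> f = g.
Proof. by case: f g => [f p] [g q] /= fg; exact: eq_exist. Qed.

Program Definition harrow_id a : harrow a a := ident a.
Next Obligation. by rewrite /ident init_edge tgt_edge !vertex0. Qed.

Program Definition harrow_comp a b c (f : harrow a b) (g : harrow b c) :
  harrow a c := compose (sval f) (sval g).
Next Obligation.
case: f g => [f [fa fb]] [g [gb gc]] /=.
by rewrite init_compose ?tgt_compose // fb gb.
Qed.

Program Definition harrow_inv a b (f : harrow a b) : harrow b a := rev (sval f).
Next Obligation. by case: f => [f [fa fb]] /=; rewrite init_rev tgt_rev. Qed.

Lemma ident_init (f : X 1) : ident (init f) = edge f ord0 ord0.
Proof. exact: esym (edge_diag f ord0). Qed.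

Lemma ident_tgt (f : X 1) : ident (tgt f) = edge f ord_max ord_max.
Proof. exact: esym (edge_diag f ord_max). Qed.

Program Definition hub_groupoid : groupoid :=
  {| ob := X 0; hom := harrow; idm := harrow_id; comp := harrow_comp;
     inv := harrow_inv |}.
Next Obligation.
apply: harrow_inj; case: f => f [/= <- fb].
by rewrite ident_init -{2 3}(edge01 f) compose_edge.
Qed.
Next Obligation.
apply: harrow_inj; case: f => f [/= fa <-].
by rewrite ident_tgt -{1 3}(edge01 f) compose_edge.
Qed.
Next Obligation.
apply: harrow_inj; case: f g h => [f [fa fb]] [g [gb gc]] [h [hc hd]] /=.
by rewrite composeA // ?fb ?gc.
Qed.
Next Obligation.
apply: harrow_inj; case: f => f [/= <- fb].
by rewrite ident_init /rev -{1}(edge01 f) compose_edge.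
Qed.
Next Obligation.
apply: harrow_inj; case: f => f [/= fa <-].
by rewrite ident_tgt /rev -{2}(edge01 f) compose_edge.
Qed.

Lemma mk_harrow_eq (a b a' b' : hub_groupoid) (h : hom a b) (h' : hom a' b') :
  sval h = sval h' -> mk_arrow h = mk_arrow h'.
Proof.
case: h h' => [f [fa fb]] [f' [fa' fb']] /= ff'.
subst f' a b a' b'; congr mk_arrow; exact: harrow_inj.
Qed.

Program Definition simplex_functor n (x : X n) :
    gfunctor (chaotic n) hub_groupoid :=
  {| fob := (fun i => vertex x i) : chaotic n -> hub_groupoid;
     fhom := fun i j _ => exist _ (edge x i j) (conj (init_edge x i j) (tgt_edge x i j)) |}.
Next Obligation. by apply: harrow_inj; rewrite /= edge_diag. Qed.
Next Obligation. by apply: harrow_inj; rewrite /= compose_edge. Qed.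

Lemma simplex_functor_act m n (u : 'I_m.+1 -> 'I_n.+1) (x : X n) :
  simplex_functor (act u x) = act u (simplex_functor x : nerve hub_groupoid n).
Proof.
by apply: chaotic_functor_eq => i j; apply: mk_harrow_eq; exact: edge_act.
Qed.

Lemma hub_complete_groupoid : is_groupoid X.
Proof.
exists hub_groupoid.
pose f : symmap X (nerve hub_groupoid) :=
  @SymMap X (nerve hub_groupoid) simplex_functor simplex_functor_act.
apply: (bij_isomorphic (f := f)).
  move=> n x y /= xy; apply: (hub_inj spX (j := ord0)) => s.
  pose e (F : gfunctor (chaotic n) hub_groupoid) : X 1 :=
    sval (@fhom _ _ F (ord0 : 'I_n.+1) (s : 'I_n.+1) tt).
  exact: (congr1 e xy).
move=> n F /=.
pose e (i j : 'I_n.+1) : X 1 := sval (@fhom _ _ F i j tt).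
have eP i j : init (e i j) = F i /\ tgt (e i j) = F j.
  by rewrite /e; case: (fhom _ _).
have eC i j k : compose (e i j) (e j k) = e i k.
  exact: (congr1 sval (esym (@fhom_comp _ _ F i j k tt tt))).
have [l|w [w0 wE]] := @hubX n (F (ord0 : 'I_n.+1)) (fun l => e ord0 (lift ord0 l)).
  by have [] := eP ord0 (lift ord0 l).
have wE0 i : edge w ord0 i = e ord0 i.
  case: (unliftP ord0 i) => [l ->|->]; first exact: wE.
  rewrite edge_diag -init_hub w0.
  exact: (congr1 sval (esym (@fhom_id _ _ F ord0))).
exists w; apply: chaotic_functor_eq => i j; apply: mk_harrow_eq => /=.
have wi : tgt (e ord0 i) = vertex w i by rewrite -wE0 tgt_edge.
(* [w] was built from the arrows out of 0; cancelling the one to [i] recovers the others. *)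
apply: (@compose_cancel (e ord0 i)).
- by rewrite init_edge wi.
- by rewrite (eP _ _).1 (eP _ _).2.
- by rewrite -{1}wE0 compose_edge wE0 eC.
Qed.

End GroupoidOfHubs.

(** * Lower Segal conditions on sets of edges *)

Lemma lift_lift n (i j : 'I_n.+3) (s : 'I_n.+1) : i < j ->
  lift j (lift (inord i : 'I_n.+2) s) = lift i (lift (inord j.-1) s).
Proof.
move=> ij; apply/val_inj; rewrite /= /bump !inordK; have := ltn_ord j; lia.
Qed.

Lemma ord_neq_exists n (I : {set 'I_n}) (i : 'I_n) : 1 < #|I| ->
  exists2 j, j \in I & j != i.
Proof.
rewrite (cardsD1 i I) => I2; have /card_gt0P[j] : 0 < #|(I :\ i)%SET|.
  by case: (i \in I) I2 => // /ltnW.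
by rewrite !inE => /andP[ji jI]; exists j.
Qed.

(* Odd vertices carry the ends of the given edges and even ones their common
   source, which makes an arbitrary set of edges gapped. *)
Lemma lower_segal_hub (X : symset) k m (I : {set 'I_m}) (g : 'I_m -> X 1)
    (v : X 0) : spiny X -> lower_segal k X -> 1 <= k -> #|I| = k.+1 ->
  (forall i, i \in I -> exists w : X m, init w = v /\
     forall l, l != i -> edge w ord0 (lift ord0 l) = g l) ->
  exists w : X m, init w = v /\ forall l, edge w ord0 (lift ord0 l) = g l.
Proof.
move=> spX segX k1 cardI.
case: m => [|p] in I g cardI *.
  by move: (max_card I); rewrite cardI card_ord.
have p1 : 1 <= p by have := max_card I; rewrite cardI card_ord; lia.
move=> gI.
have /choice[w wP] : forall i, exists w : X p.+1, i \in I -> init w = v /\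
    forall l, l != i -> edge w ord0 (lift ord0 l) = g l.
  move=> i; case: (boolP (i \in I)) => [/gI[w wP]|_]; first by exists w.
  by exists (act (fun=> ord0) v).
(* The top vertex is [n.+2 = 2p + 2], so the odd vertices 1, 3, ..., 2p + 1 match the [p + 1]
   edges. *)
pose n := p.*2.
pose psi (l : 'I_p.+1) : 'I_n.+3 := inord l.*2.+1.
pose half (q : 'I_n.+3) : 'I_p.+1 := inord q./2.
pose phi (q : 'I_n.+3) : 'I_p.+2 := if odd q then lift ord0 (half q) else ord0.
have psiE l : val (psi l) = l.*2.+1.
  by rewrite /psi /= inordK // /n; have := ltn_ord l; lia.
have psiK : cancel psi half.
  by move=> l; apply/val_inj; rewrite /half /= psiE inordK; have := ltn_ord l; lia.
have halfK (q : 'I_n.+3) : odd q -> psi (half q) = q.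
  move=> qo; apply/val_inj; rewrite psiE /half inordK; last first.
    by have := ltn_ord q; rewrite /n; lia.
  by rewrite -[RHS]odd_double_half qo.
pose J : {set 'I_n.+3} := [set psi l | l in I]%SET.
have JP q : q \in J -> odd q /\ half q \in I.
  by case/imsetP => l lI ->; rewrite psiK psiE /= odd_double.
have gapJ : gapped J.
  by move=> _ _ /imsetP[a _ ->] /imsetP[b _ ->]; rewrite !psiE; lia.
have cardJ : #|J| = k.+1 by rewrite card_imset //; exact: can_inj psiK.
(* [W i] is as prescribed except at [psi i], where [w i] is unconstrained; the face taken in [x]
   omits that vertex. *)
pose W i : X n.+2 := act phi (w i).
have edgeW i (q : 'I_n.+3) : i \in I -> q != psi i -> edge (W i) ord0 q =
    if odd q then g (half q) else edge v ord0 ord0.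
  move=> iI qi; rewrite edge_act {1 2}/phi /=; case: ifP => qo.
    by apply: (wP i iI).2; apply: contra qi => /eqP <-; rewrite halfK.
  by rewrite edge_diag -init_hub (wP i iI).1.
pose x (q : {q : 'I_n.+3 | q \in J}) : X n.+1 := face (val q) (W (half (val q))).
have [|y [yx _]] := segX n J gapJ cardJ x.
  move=> [q qJ] [q' q'J] /= qq'; have [qo qI] := JP q qJ; have [q'o q'I] := JP q' q'J.
  apply: (hub_inj spX (j := ord0)) => s; rewrite /x /face /= 2![in LHS]edge_act 2![in RHS]edge_act.
  have -> : lift q' (lift (inord q) ord0) = ord0.
    by apply/val_inj; rewrite /= /bump inordK; have := ltn_ord q'; lia.
  have -> : lift q (lift (inord q'.-1) ord0) = ord0.
    by apply/val_inj; rewrite /= /bump inordK; have := ltn_ord q'; lia.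
  rewrite !edgeW ?halfK //; try by rewrite eq_sym neq_lift.
  by rewrite lift_lift.
have yE (q : 'I_n.+3) : edge y ord0 q = if odd q then g (half q) else edge v ord0 ord0.
  (* As [J] has at least two elements, some face of [y] still contains the edge from 0 to [q]. *)
  have [j jJ jq] : exists2 j, j \in J & j != q by apply: ord_neq_exists; lia.
  have [jo jI] := JP j jJ.
  have [r qE] : exists r, q = lift j r.
    by case: (unliftP j q) jq => [r ->|->]; [exists r|rewrite eqxx].
  have j0 : ord0 = lift j ord0 by apply/val_inj; rewrite /= /bump; lia.
  rewrite -(edgeW (half j)) ?halfK // 1?eq_sym // qE j0.
  have := yx (exist _ j jJ); rewrite /x /= => /(congr1 (fun u => edge u ord0 r)).
  by rewrite !edge_act -j0.
exists (act (fun s => if unlift ord0 s is Some l then psi l else ord0) y).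
split=> [|l]; last first.
  by rewrite edge_act unlift_none liftK yE psiE /= odd_double psiK.
rewrite init_hub vertex_act unlift_none -(init_edge _ _ ord0) yE /=.
by rewrite init_edge vertex0.
Qed.

(** Induction on the number of edges: if there are at least two, omitting the first or the last
    leaves a simplex, and two such omissions suffice when [k = 1]. *)
Lemma lower_segal1_hub_complete (X : symset) :
  spiny X -> lower_segal 1 X -> hub_complete X.
Proof.
move=> spX segX; elim=> [|m IHm] z g gz.
  by exists z; split=> [|[]//]; exact: vertex0.
case: m => [|m] in IHm g gz *.
  exists (g ord0); split=> // l; rewrite (ord1 l) -[RHS]edge01.
  by congr edge; apply/val_inj.
apply: (@lower_segal_hub X 1 _ [set ord0; ord_max]%SET) => //.
  by rewrite cards2.
move=> i _.
have [w [w0 wE]] := IHm z (g \o lift i) (fun l => gz _).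
(* The end of the omitted edge is collapsed onto the hub. *)
exists (act (fun s => if unlift ord0 s is Some l then
   if unlift i l is Some l' then lift ord0 l' else ord0 else ord0) w).
split=> [|l li]; first by rewrite init_hub vertex_act unlift_none.
rewrite edge_act unlift_none liftK.
case: unliftP li => [l' -> _|->]; last by rewrite eqxx.
by rewrite wE.
Qed.

(** * Fillers *)

Lemma lift_exists n (i q : 'I_n.+1) : q != i -> exists a, lift i a = q.
Proof. by case: (unliftP i q) => [a -> _|->]; [exists a|rewrite eqxx]. Qed.

Lemma face_edge (X : symset) n (i : 'I_n.+2) (y : X n.+1) a b :
  edge (face i y) a b = edge y (lift i a) (lift i b).
Proof. exact: edge_act. Qed.

(** An edge in both faces avoids both omitted vertices, so it lies in their common face of
    codimension two, where [x] and [x'] agree. *)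
Lemma compatible_edge (X : symset) n (i i' : 'I_n.+3) (x x' : X n.+1)
    (a b a' b' : 'I_n.+2) : i < i' ->
  face (inord i) x' = face (inord i'.-1) x ->
  lift i a = lift i' a' -> lift i b = lift i' b' ->
  edge x a b = edge x' a' b'.
Proof.
move=> ii' xx'.
have split_lift (c c' : 'I_n.+2) : lift i c = lift i' c' ->
    exists s : 'I_n.+1, c = lift (inord i'.-1) s /\ c' = lift (inord i) s.
  move=> cc'.
  have /lift_exists[s sc] : c' != inord i.
    apply/eqP => c'i; have := congr1 val cc'.
    rewrite c'i /= /bump inordK; have := ltn_ord i'; lia.
  exists s; split=> //; apply: (@lift_inj _ i).
  by rewrite cc' -sc lift_lift.
move=> /split_lift[s [-> ->]] /split_lift[t [-> ->]].
by rewrite -!face_edge xx'.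
Qed.

(** For [j] outside [I] and [1 < #|I|], [g l] is the edge from [j] to [l] that any filler must
    have. *)
Definition hub_edges (X : symset) n (I : {set 'I_n.+3})
    (x : {i : 'I_n.+3 | i \in I} -> X n.+1) (j : 'I_n.+3)
    (g : 'I_n.+3 -> X 1) : Prop :=
  forall l (i : {i : 'I_n.+3 | i \in I}) a b,
    lift (val i) a = j -> lift (val i) b = l -> edge (x i) a b = g l.

Section Filler.
Variables (X : symset) (n : nat) (I : {set 'I_n.+3}).
Variable x : {i : 'I_n.+3 | i \in I} -> X n.+1.
Variable j : 'I_n.+3.
Hypotheses (I_gt1 : 1 < #|I|) (jI : j \notin I).

Lemma other_face l : exists (i : {i : 'I_n.+3 | i \in I}) a b,
  lift (val i) a = j /\ lift (val i) b = l.
Proof.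
have [i iI il] := ord_neq_exists l I_gt1.
have [|a aj] := @lift_exists _ i j; first by apply: contraNneq jI => ->.
have [|b bl] := @lift_exists _ i l; first by rewrite eq_sym.
by exists (exist _ i iI), a, b.
Qed.

Lemma hub_edges_exist :
  (forall i i' : {i : 'I_n.+3 | i \in I}, val i < val i' ->
     face (inord (val i)) (x i') = face (inord (val i').-1) (x i)) ->
  exists g, hub_edges x j g.
Proof.
move=> compat; suff /choice[g gP] : forall l, exists gl, forall i a b,
  lift (val i) a = j -> lift (val i) b = l -> edge (x i) a b = gl by exists g.
move=> l.
have [i [a [b [aj bl]]]] := other_face l.
exists (edge (x i) a b) => i' a' b' aj' bl'.
case: (ltngtP (val i) (val i')) => ii'.
- by apply/esym/(compatible_edge ii' (compat _ _ ii')); congruence.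
- by apply/(compatible_edge ii' (compat _ _ ii')); congruence.
- have {}ii' : i' = i by apply/val_inj/val_inj.
  move: aj' bl'; rewrite ii' -aj -bl => /lift_inj -> /lift_inj ->; done.
Qed.

Lemma filler_unique (y y' : X n.+2) : spiny X ->
  (forall i : {i : 'I_n.+3 | i \in I}, face (val i) y = face (val i) y') ->
  y = y'.
Proof.
move=> spX yy'; apply: (hub_inj spX (j := j)) => l.
by have [i [a [b [<- <-]]]] := other_face l; rewrite -!face_edge yy'.
Qed.

End Filler.

Lemma lift_hub (E L : symset) (rho : symmap E L) n (j : 'I_n.+1)
    (g : 'I_n.+1 -> L 1) (z : E 0) :
  hub_complete E -> g j = edge (g j) ord0 ord0 ->
  (forall l, domain rho (g l) z) ->
  exists2 y : E n, vertex y j = z & forall l, edge (rho n y) j l = g l.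
Proof.
move=> hubE gj /choice[e eP].
have [w [wz we]] := hubE _ z e (fun l => (eP l).1).
(* [w] has an extra vertex, the end of the lift of [g j]. It is dropped, since the edge from the hub
   to itself is degenerate, as [gj] requires. *)
exists (act (fun l => if l == j then ord0 else lift ord0 l) w) => [|l].
  by rewrite vertex_act eqxx -wz.
rewrite /edge -symmap_act -/(edge _ j l) edge_act eqxx.
case: eqVneq => [->|_]; last by rewrite we (eP l).2.
rewrite edge_diag -init_hub wz -(eP j).1 init_hub -edge_diag.
by rewrite /edge symmap_act (eP j).2 -/(edge _ _ _).
Qed.

(* Fillers exist in [L] because they do in the groupoid [E]. *)
Lemma filler_of_lifts (E L : symset) (rho : symmap E L) n (I : {set 'I_n.+3})
    (x : {i : 'I_n.+3 | i \in I} -> L n.+1) (j : 'I_n.+3) (g : 'I_n.+3 -> L 1)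
    (z : E 0) : hub_complete E -> spiny L -> 1 < #|I| -> j \notin I ->
  hub_edges x j g -> (forall l, domain rho (g l) z) ->
  exists! y : L n.+2, forall i : {i : 'I_n.+3 | i \in I}, face (val i) y = x i.
Proof.
move=> hubE spL I1 jI gP gz.
have gj : g j = edge (g j) ord0 ord0.
  have [i [a [b [aj bj]]]] := other_face I1 jI j.
  rewrite -(gP j i a b aj bj) edge_edge; congr edge.
  by apply: (@lift_inj _ (val i)); rewrite aj bj.
have [y _ yE] := lift_hub hubE gj gz.
have yx (i : {i : 'I_n.+3 | i \in I}) : face (val i) (rho _ y) = x i.
  have [a aj] : exists a, lift (val i) a = j.
    by apply: lift_exists; apply: contraNneq jI => ->; exact: valP.
  apply: (hub_inj spL (j := a)) => s.
  by rewrite face_edge aj yE; apply/esym/gP.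
exists (rho _ y); split=> // y' y'x; apply: (filler_unique I1 jI spL) => i.
by rewrite yx y'x.
Qed.

(** * Degree and Helly number *)

Lemma enat_ofP (Q : nat -> Prop) :
  if enat_of Q is Some k then Q k else ~ exists k, Q k.
Proof. by rewrite /enat_of; case: pselect => // e; case: cid. Qed.

Lemma least_exists (P : nat -> Prop) : (exists n, P n) -> exists k, least P k.
Proof.
move=> [n Pn]; have Pn' : exists n, `[< P n >] by exists n; apply/asboolP.
case: (ex_minnP Pn') => k /asboolP Pk kmin.
by exists k; split=> // m Pm; apply: kmin; apply/asboolP.
Qed.

Lemma greatest_exists (P : nat -> Prop) m : (exists n, P n) ->
  (forall n, P n -> n <= m) -> exists k, greatest P k.
Proof.
move=> [n Pn] Pm; have Pn' : exists n, `[< P n >] by exists n; apply/asboolP.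
have Pm' i : `[< P i >] -> i <= m by move/asboolP/Pm.
case: (ex_maxnP Pn' Pm') => k /asboolP Pk kmax.
by exists k; split=> // i Pi; apply: kmax; apply/asboolP.
Qed.

(** A gapped set cannot contain both 0 and 1. *)
Lemma gapped_hub n (I : {set 'I_n.+3}) : gapped I -> exists j, j \notin I.
Proof.
move=> gapI; case: (boolP (ord0 \in I)) => I0; last by exists ord0.
exists (inord 1); apply/negP => I1.
by have := gapI _ _ I0 I1; rewrite !inordK //= => /(_ isT).
Qed.

(** Otherwise, iterating the step by choice gives a strictly descending chain of closed sets. *)
Lemma dcc_reaches_set0 (S : Type) (cl : set S -> set S) (P : set S -> Prop) :
  dcc_closed cl -> (forall W, P W -> cl_closed cl W) -> (exists W, P W) ->
  (forall W, P W -> W !=set0 -> exists W', [/\ P W', W' `<=` W & ~ W `<=` W']) ->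
  P set0.
Proof.
move=> dcc Pcl [W0 PW0] step; apply: contrapT => P0.
have /choice[f fP] : forall W, exists W', P W -> [/\ P W', W' `<=` W & ~ W `<=` W'].
  move=> W; have [PW|nPW] := pselect (P W); last by exists W.
  have [|W' W'P] := step W PW; last by exists W'.
  by apply/set0P/eqP => We; apply: P0; rewrite -We.
pose C n := iter n f W0.
have PC n : P (C n) by elim: n => [//|n IHn]; have [] := fP _ IHn.
have [|n|N CN] := dcc C; first by move=> n; apply/Pcl/PC.
  by have [] := fP _ (PC n).
have [_ _] := fP _ (PC N); apply; rewrite -[f _]/(C N.+1).
by rewrite (CN N.+1).
Qed.

(** * Bounding the degree by the Helly number *)

Section Characteristic.
Variables (E L : symset) (rho : symmap E L).
Hypotheses (spL : spiny L) (hubE : hub_complete E).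
Hypothesis rho_surj : forall n (f : L n), exists e : E n, rho n e = f.

Local Notation D := (domain rho).
Local Notation cl := (cl_rho rho).

Lemma lower_segal_of_common_lift k : 1 <= k ->
  (forall n (I : {set 'I_n.+3}) (x : {i : 'I_n.+3 | i \in I} -> L n.+1) j g,
     #|I| = k.+1 -> j \notin I -> hub_edges x j g ->
     exists z, forall l, D (g l) z) ->
  lower_segal k L.
Proof.
move=> k1 lifts n I gapI cardI x compat.
have [j jI] := gapped_hub gapI; have I1 : 1 < #|I| by rewrite cardI.
have [g gP] := hub_edges_exist I1 jI compat.
by have [z zP] := lifts n I x j g cardI jI gP; apply: (filler_of_lifts hubE spL I1 jI gP zP).
Qed.

Lemma lower_segal1_groupoid : lower_segal 1 L -> is_groupoid L.
Proof.
by move=> segL; apply: hub_complete_groupoid => //; apply: lower_segal1_hub_complete.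
Qed.

(** A point in the closure of the empty set lies in every domain, so all hubs lift there and [L] is
    lower 1-Segal. *)
Lemma cl_rho_set0 : ~ is_groupoid L -> cl set0 = set0.
Proof.
move=> Lng; apply: contrapT => /eqP/set0P[z zP]; apply/Lng/lower_segal1_groupoid.
apply: lower_segal_of_common_lift => // n I x j g _ _ _.
by exists z => l; apply: zP.
Qed.

(** If [E 0] were empty, [L] would have no simplices and be vacuously lower 1-Segal. *)
Lemma inhabited_total : ~ is_groupoid L -> exists z : E 0, True.
Proof.
move=> Lng; apply: contrapT => E0; apply/Lng/lower_segal1_groupoid.
move=> n I _ cardI x _.
have /card_gt0P[i iI] : 0 < #|I| by rewrite cardI.
have [e _] := rho_surj (x (exist _ i iI)).
by case: E0; exists (init e).
Qed.

Lemma not_Helly_lower_segal h : 1 <= h ->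
  ~ (exists A : 'I_h.+1 -> set (E 0), Helly_independent cl A) ->
  lower_segal h L.
Proof.
move=> h1 noA; apply: lower_segal_of_common_lift => // n I x j g cardI jI gP.
have I1 : 1 < #|I| by rewrite cardI.
apply: contrapT => noz; apply: noA; rewrite -cardI.
have /choice[e eP] : forall i, exists e, rho n.+1 e = x i by move=> i; exact: rho_surj.
have /choice[a aP] : forall i : {i : 'I_n.+3 | i \in I}, exists a, lift (val i) a = j.
  by move=> i; apply: lift_exists; apply: contraNneq jI => ->; exact: valP.
pose idx (t : 'I_#|I|) : {i : 'I_n.+3 | i \in I} := exist _ (enum_val t) (enum_valP t).
(* The lift [e i] of [x i] contains, at its vertex over [j], a lift of every edge from [j] in that
   face. *)
have inD i l : l != val i -> D (g l) (vertex (e i) (a i)).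
  move=> /lift_exists[b bl]; exists (edge (e i) (a i) b); split.
    exact: init_edge.
  by rewrite /edge symmap_act eP; apply: gP.
exists (fun t => [set vertex (e (idx t)) (a (idx t))]); split.
  by move=> t; exists (vertex (e (idx t)) (a (idx t))).
apply: contrapT => /eqP/set0P[z [zall zbut]]; apply: noz; exists z => l.
(* For [l] outside [I] all chosen points lie in [D (g l)]; for [l] in [I] all but possibly the one
   indexed by [l] do. *)
have [lI|lI] := boolP (l \in I); last first.
  by apply: zall => _ [t _ ->]; apply: inD; apply: contraNneq lI => ->; exact: valP.
apply: (zbut (enum_rank_in lI l)) => // _ [t tl ->]; apply: inD.
by apply/eqP => lt; apply/tl/enum_val_inj; rewrite enum_rankK_in.
Qed.

(** * Bounding the Helly number by the degree *)

Lemma domain_edge n (f : L n) l : D f `<=` D (edge f ord0 l).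
Proof.
move=> z [e [ez ef]]; exists (edge e ord0 l); split; first by rewrite init_edge.
by rewrite /edge symmap_act ef.
Qed.

(** With [domain_edge], this makes every domain a finite intersection of domains of edges. *)
Lemma domain_edges n (f : L n) z : (forall l, D (edge f ord0 l) z) -> D f z.
Proof.
move=> fz; have [|//|y yz yf] := @lift_hub _ _ rho n ord0 (edge f ord0) z hubE.
  by rewrite edge_edge.
by exists y; split=> //; apply: (hub_inj spL yf).
Qed.

Lemma domain_init n (f : L n) z : D f z -> rho 0 z = init f.
Proof. by case=> e [<- <-]; exact: symmap_act. Qed.

(** By independence, any point of a finite intersection of such domains is missed by some domain
    containing some [B i], hence by that of one of its edges. So the intersections shrink until
    empty. *)
Lemma Helly_finite_subfamily N (A : 'I_N -> set (E 0)) : 0 < N ->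
  dcc_closed cl -> Helly_independent cl A ->
  exists m (g : 'I_m -> L 1),
    (forall t, exists i, \bigcup_(j in [set j | j <> i]) A j `<=` D (g t)) /\
    forall z, ~ forall t, D (g t) z.
Proof.
move=> N0 dcc [_ Acap].
pose B i := \bigcup_(j in [set j | j <> i]) A j.
pose P W := exists m (g : 'I_m -> L 1),
  (forall t, exists i, B i `<=` D (g t)) /\ W = [set z | forall t, D (g t) z].
suff [m [g [gB g0]]] : P set0.
  by exists m, g; split=> // z gz; have : [set z | forall t, D (g t) z] z by []; rewrite -g0.
apply: (dcc_reaches_set0 dcc).
- move=> _ [m [g [_ ->]]]; rewrite /cl_closed; apply/seteqP; split=> z zP.
    by move=> t; apply: zP => y; apply.
  by move=> n f; apply.
- by exists setT, 0, (fun t : 'I_0 => False_rect _ (notF (ltn_ord t)));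
    split=> [[]//|]; apply/seteqP; split=> // z _ [].
move=> _ [m [g [gB ->]]] [z zg].
have [i [n [f [Bf fz]]]] : exists i n (f : L n), B i `<=` D f /\ ~ D f z.
  apply: contrapT => nof.
  have zB i : cl (B i) z.
    by move=> n f Bf; apply: contrapT => fz; apply: nof; exists i, n, f.
  have : set0 z; last by [].
  rewrite -Acap; split=> [n f Af|i _]; last exact: zB.
  (* The union of all [A j] contains [B] at index 0, so its closure contains [z] as well. *)
  apply: (zB (Ordinal N0)).
  by move=> y [j _ Ajy]; apply: Af; exists j.
have [l flz] : exists l, ~ D (edge f ord0 l) z.
  by apply/existsNP => fzl; apply/fz/domain_edges.
pose g' (t : 'I_m.+1) := if unlift ord0 t is Some t' then g t' else edge f ord0 l.
exists [set z | forall t, D (g' t) z]; split.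
- exists m.+1, g'; split=> // t; rewrite /g'; case: unliftP => [t' _|_] //.
  by exists i => y /Bf /domain_edge.
- by move=> y yg' t; have := yg' (lift ord0 t); rewrite /g' liftK.
- by move=> /(_ z zg) /(_ ord0); rewrite /g' unlift_none.
Qed.

Lemma Helly_le_lower_segal k N (A : 'I_N -> set (E 0)) : 2 <= k ->
  lower_segal k L -> dcc_closed cl -> Helly_independent cl A -> N <= k.
Proof.
move=> k2 segL dcc hA; case: (leqP N k) => // kN; exfalso.
have N0 : 0 < N by exact: leq_ltn_trans kN.
have [m [g [gB g0]]] := Helly_finite_subfamily N0 dcc hA.
have [A0 _] := hA.
have {gB}/choice[tau tauP] : forall t, exists i, forall j, j != i -> A j `<=` D (g t).
  by move=> t; have [i iP] := gB t; exists i => j /eqP ji y Ajy; apply: iP; exists j.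
have [|M /minsetP[/asboolP M0 Mmin] _] :=
    @minset_exists _ (fun M : {set 'I_m} => `[< forall z, ~ forall t, t \in M -> D (g t) z >]) [set: 'I_m]%SET.
  by apply/asboolP => z zg; apply: (g0 z) => t; apply: zg; rewrite inE.
(* If [i] were exceptional for no edge of [M], a point of [A i] would lift them all. *)
have tauM i : exists2 t, t \in M & tau t = i.
  apply: contrapT => noi; have [y yA] := A0 i.
  apply: (M0 y) => t tM; apply: (tauP t i) => //.
  by apply/eqP => it; apply: noi; exists t.
have NM : N <= #|M|.
  rewrite -{1}(card_ord N); apply: leq_trans (leq_imset_card tau M).
  apply/subset_leq_card/fintype.subsetP => i _; have [t tM <-] := tauM i; exact: imset_f.
have M1 : 1 < #|M| by apply: leq_trans NM; apply: leq_trans kN; apply: leqW.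
have [t0 t0M _] := tauM (Ordinal N0).
(* As [N] is at least 3, some [p] is exceptional for neither edge; a point of [A p] lifts both and
   determines their source. *)
have initM t : t \in M -> init (g t) = init (g t0).
  move=> tM.
  have [p] : exists p, p \notin [set tau t; tau t0]%SET.
    apply/existsP; rewrite -negb_forall; apply/negP => /forallP allp.
    have : N <= 2.
      rewrite -{1}(card_ord N); apply: leq_trans (_ : #|[set tau t; tau t0]%SET| <= 2).
        by apply/subset_leq_card/fintype.subsetP => p _; exact: allp.
      by rewrite cards2; case: (_ != _).
    by move=> N2; have := leq_trans kN N2; rewrite ltnNge k2.
  rewrite !inE negb_or => /andP[pt pt0]; have [y yA] := A0 p.
  by rewrite -(domain_init (tauP t p pt y yA)) -(domain_init (tauP t0 p pt0 y yA)).
set v := init (g t0) in initM.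
have kM : k < #|M| by exact: leq_trans NM.
(* Any [k + 1] edges of [M] would do: by minimality, removing any one edge leaves a common lift. *)
pose I := [set widen_ord kM i | i : 'I_k.+1]%SET.
have cardI : #|I| = k.+1.
  by rewrite card_imset ?card_ord // => i i' /(congr1 val) /= /val_inj.
have [||w [wv wg]] := @lower_segal_hub L k #|M| I (fun l => g (enum_val l)) v spL segL _ cardI.
- exact: ltnW.
- move=> i _.
  have [z zP] : exists z, forall t, t \in (M :\ enum_val i)%SET -> D (g t) z.
    apply: contrapT => noz.
    have /Mmin : `[< forall z, ~ forall t, t \in (M :\ enum_val i)%SET -> D (g t) z >].
      by apply/asboolP => z zP; apply: noz; exists z.
    move/(_ (subD1set _ _))/setP/(_ (enum_val i)).
    by rewrite !inE eqxx enum_valP.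
  have rz : rho 0 z = v.
    have [t tM ti] := ord_neq_exists (enum_val i) M1.
    by rewrite -(initM t tM); apply: domain_init; apply: zP; rewrite !inE ti.
  (* A degenerate edge at [v] replaces the removed one, so that the whole hub lifts at [z]. *)
  pose gi (s : 'I_#|M|.+1) := if unlift ord0 s is Some l then
    if l == i then edge v ord0 ord0 else g (enum_val l) else edge v ord0 ord0.
  have zv : D (edge v ord0 ord0) z.
    exists (edge z ord0 ord0); split; first by rewrite init_edge vertex0.
    by rewrite /edge symmap_act rz.
  have [|s|y yz yE] := @lift_hub _ _ rho _ ord0 gi z hubE.
  + by rewrite /gi unlift_none edge_edge.
  + rewrite /gi; case: unliftP => [l _|_] //; case: eqVneq => // li.
    by apply: zP; rewrite !inE enum_valP andbT (inj_eq enum_val_inj).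
  exists (rho _ y); split.
    by rewrite /init -symmap_act -/(init y) init_hub yz.
  by move=> l li; rewrite yE /gi liftK (negbTE li).
(* The initial vertex of a lift of [w] lifts all edges of [M], a contradiction. *)
have [e ew] := rho_surj w.
apply: (M0 (init e)) => t tM.
exists (edge e ord0 (lift ord0 (enum_rank_in tM t))); split; first exact: init_edge.
by rewrite /edge symmap_act ew -/(edge _ _ _) wg enum_rankK_in.
Qed.

End Characteristic.

Theorem theorem8p1 (E L : partial_groupoid) (rho : symmap E L) :
  characteristic rho -> ~ is_groupoid L ->
  le_enat (deg L) (helly_number (cl_rho rho)) /\
  (dcc_closed (cl_rho rho) ->
   le_enat (helly_number (cl_rho rho)) (deg L)).
Proof.
move=> [_ /groupoid_hub_complete hubE rho_surj] Lng.
have spL : spiny L := @pg_spiny L.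
have cl0 := cl_rho_set0 rho spL hubE Lng.
have [z _] := inhabited_total spL rho_surj Lng.
have Helly1 : exists A : 'I_1 -> set (E 0), Helly_independent (cl_rho rho) A.
  (* Removing the only set leaves the closure of the empty set, which is empty. *)
  exists (fun _ => [set z]); split; first by move=> _; exists z.
  apply/seteqP; split=> // y [_ /(_ ord0 I)].
  rewrite (_ : \bigcup_(j in _) _ = set0) ?cl0 //.
  by apply/seteqP; split=> // u [j /= jn0]; case: jn0; apply: ord1.
rewrite /deg /helly_number; split.
  have := enat_ofP (greatest (fun n => exists A : 'I_n -> set (E 0), Helly_independent (cl_rho rho) A)).
  case: enat_of => [h [_ hmax]|_]; last by case: enat_of.
  have h1 := hmax 1 Helly1.
  have segh : 1 <= h /\ lower_segal h L.
    split=> //; apply: (not_Helly_lower_segal spL hubE rho_surj h1).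
    by move=> /hmax; rewrite ltnn.
  have := enat_ofP (least (fun k => 1 <= k /\ lower_segal k L)).
  case: enat_of => [k [_ kmin]|[]]; first exact: kmin.
  by apply: least_exists; exists h.
move=> dcc.
have := enat_ofP (least (fun k => 1 <= k /\ lower_segal k L)).
case: (enat_of (least _)) => [k [[k1 segk] _]|_]; last by case: enat_of.
(* More than [k] sets then means at least three, as the common source of the edges requires. *)
have k2 : 2 <= k.
  rewrite ltn_neqAle k1 andbT; apply/eqP => k1'; rewrite -k1' in segk.
  exact/Lng/lower_segal1_groupoid.
have bound n : (exists A : 'I_n -> set (E 0), Helly_independent (cl_rho rho) A) -> n <= k.
  by move=> [A]; apply: (Helly_le_lower_segal spL hubE rho_surj k2 segk dcc).
have := enat_ofP (greatest (fun n => exists A : 'I_n -> set (E 0), Helly_independent (cl_rho rho) A)).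
case: enat_of => [h [/bound //]|[]].
(* Size 1 occurs and sizes are bounded, so the Helly number is finite. *)
by apply: greatest_exists bound; exists 1.
Qed.
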